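(* Let $\Omega$ be an alphabet, and let $P$ be a computable finite probability space on $\Omega$. Let $\alpha\in\Omega^\infty$ be Schnorr $P$-random. Let $\varepsilon$ be an arbitrary positive real. Then there exists $M\in\mathbb{N}^+$ such that for every integer $n\ge M$ and every $k\in\mathbb{N}^+$, if $k\ge n^{2+\varepsilon}$ then for every $a\in\Omega$ it holds that $$\left|\frac{N_a(\alpha\restriction_k)}{k}-P(a)\right|<\frac{1}{n}.$$
   Context: $\mathbb{N}=\{0,1,2,\dots\}$ and $\mathbb{N}^+$ is the set of positive integers. An alphabet is a non-empty finite set. For an alphabet $\Omega$, $\Omega^*$ is the set of finite strings over $\Omega$ (including the empty string) and $\Omega^\infty$ is the set of infinite sequences $\alpha=\alpha(1)\alpha(2)\cdots$ over $\Omega$; $\alpha\restriction_n$ is the string of the first $n$ elements of $\alpha$. For $a\in\Omega$ and $\sigma\in\Omega^*$, $N_a(\sigma)$ is the number of occurrences of $a$ in $\sigma$. For $S\subset\Omega^*$, $[S]^{\prec}=\{\alpha\in\Omega^\infty\mid \exists n\in\mathbb{N}\ \alpha\restriction_n\in S\}$. A finite probability space on $\Omega$ is a function $P\colon\Omega\to\mathbb{R}$ with $P(a)\ge 0$ for all $a\in\Omega$ and $\sum_{a\in\Omega}P(a)=1$. A real $x$ is computable if there is a total recursive $f\colon\mathbb{N}\to\mathbb{Q}$ with $|x-f(k)|<2^{-k}$ for all $k\in\mathbb{N}$; $P$ is computable if $P(a)$ is a computable real for every $a\in\Omega$. The Bernoulli measure $\lambda_P$ is the probability measure on the Borel $\sigma$-field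 of $\Omega^\infty$ (generated by all sets $[S]^{\prec}$) with $\lambda_P([\{\sigma_1\cdots\sigma_n\}]^{\prec})=P(\sigma_1)\cdots P(\sigma_n)$ for every string $\sigma_1\cdots\sigma_n\in\Omega^*$. A Martin-Löf $P$-test is an r.e. (recursively enumerable) set $\mathcal{C}\subset\mathbb{N}^+\times\Omega^*$ such that $\lambda_P([\mathcal{C}_n]^{\prec})<2^{-n}$ for every $n\in\mathbb{N}^+$, where $\mathcal{C}_n=\{\sigma\mid(n,\sigma)\in\mathcal{C}\}$. A Schnorr $P$-test is a Martin-Löf $P$-test $\mathcal{C}$ for which there is a total recursive $f\colon\mathbb{N}^+\times\mathbb{N}\to\mathbb{Q}$ with $|\lambda_P([\mathcal{C}_n]^{\prec})-f(n,k)|<2^{-k}$ for all $n\in\mathbb{N}^+$, $k\in\mathbb{N}$. A sequence $\alpha\in\Omega^\infty$ passes $\mathcal{C}$ if $\alpha\notin[\mathcal{C}_n]^{\prec}$ for some $n\in\mathbb{N}^+$. $\alpha$ is Schnorr $P$-random if it passes every Schnorr $P$-test. *)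

(* Defs.v *)
From HB Require Import structures.
From mathcomp Require Import all_boot all_order all_algebra.
From mathcomp Require Import all_classical all_reals all_analysis.

Set Implicit Arguments.
Unset Strict Implicit.
Unset Printing Implicit Defensive.

Import Order.TTheory GRing.Theory Num.Theory.
Import numFieldNormedType.Exports.

Local Open Scope classical_set_scope.
Local Open Scope ring_scope.

(* Kleene's partial recursive functions.  A code denotes the graph of a
   partial function of finitely many natural numbers, presented as a list;
   projections beyond the length of the list read 0.  [Prec f g] is the function
   h with h(0, u) = f(u) and h(m + 1, u) = g(m, h(m, u), u). *)
Inductive code :=
  | Zero
  | Succ
  | Proj of nat
  | Comp of code & seq code
  | Prec of code & code
  | Mu of code.

Section All2P.
Variables (S T : Type) (r : S -> T -> Prop).

Fixpoint all2P (s : seq S) (t : seq T) : Prop :=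
  match s, t with
  | [::], [::] => True
  | x :: s', y :: t' => r x y /\ all2P s' t'
  | _, _ => False
  end.

End All2P.

Section PrecGraph.
Variables (F G : seq nat -> nat -> Prop) (u : seq nat).

Fixpoint prec_graph (n y : nat) : Prop :=
  if n is m.+1 then exists z, prec_graph m z /\ G [:: m, z & u] y else F u y.

End PrecGraph.

(* [eval c v y]: the computation of [c] on input [v] halts with output [y]. *)
Fixpoint eval (c : code) (v : seq nat) (y : nat) {struct c} : Prop :=
  match c with
  | Zero => y = 0%N
  | Succ => y = (head 0%N v).+1
  | Proj i => y = nth 0%N v i
  | Comp f gs => exists ws, all2P (fun g => eval g v) gs ws /\ eval f ws y
  | Prec f g => prec_graph (eval f) (eval g) (behead v) (head 0%N v) y
  | Mu f => eval f (y :: v) 0%N /\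
            forall z, (z < y)%N -> exists w, eval f (z :: v) w.+1
  end.

Lemma eval_det (c : code) (v : seq nat) (y z : nat) :
  eval c v y -> eval c v z -> y = z.
Proof.
move: c v y z; fix IH 1 => -[||i|f gs|f g|f] v y z /=.
- by move=> -> ->.
- by move=> -> ->.
- by move=> -> ->.
- case=> ws [hws hy] [ws' [hws' hz]].
  have e : ws = ws'.
    move: hws hws'; clear hy hz; move: gs ws ws'; fix IHs 1.
    case=> [|g gs] [|w ws] [|w' ws'] //= [h1 h2] [h1' h2'].
    by rewrite (IH g v w w' h1 h1') (IHs gs ws ws' h2 h2').
  by rewrite e in hy; exact: IH f ws' y z hy hz.
- elim: (head 0%N v) y z => [|n IHn] y z /=; first exact: IH.
  by move=> [a [/IHn ha hy]] [b [/ha <- hz]]; exact: IH g _ _ _ hy hz.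
- move=> [hy ltyP] [hz ltzP].
  have [/ltzP[w hw]|/ltyP[w hw]|//] := ltngtP y z.
    by have := IH f _ _ _ hy hw.
  by have := IH f _ _ _ hz hw.
Qed.

Definition total_recursive (n : nat) (f : n.-tuple nat -> nat) : Prop :=
  exists c : code, forall v : n.-tuple nat, eval c v (f v).

(* A rational is presented by a sign, a numerator and a non-zero denominator. *)
Definition total_recursive_rat (n : nat) (f : n.-tuple nat -> rat) : Prop :=
  exists s p q : n.-tuple nat -> nat,
    [/\ total_recursive s, total_recursive p, total_recursive q &
        forall v, f v = (-1) ^+ s v * (p v)%:R / (q v).+1%:R].

Definition computable_real (R : realType) (x : R) : Prop :=
  exists f : 1.-tuple nat -> rat, total_recursive_rat f /\
    forall k : nat, `|x - ratr (f [tuple k])| < 2%:R ^- k.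

(* An alphabet is a non-empty finite set; the distinguished element [point]
   required by measurable types is only a witness of non-emptiness. *)
#[short(type="alphabetType")]
HB.structure Definition Alphabet := {T of Finite T & isPointed T}.

(* The rank of a string in the length-lexicographic enumeration of all strings,
   i.e., its value in bijective base-[#|Omega|] numeration. *)
Definition string_code (Omega : finType) (sigma : seq Omega) : nat :=
  foldl (fun m a => m * #|Omega| + (enum_rank a).+1)%N 0%N sigma.

Lemma string_code_inj (Omega : finType) : injective (@string_code Omega).
Proof.
move=> s t; elim/last_ind: s t => [|s a IHs] t; case/lastP: t => [|t b] //;
  rewrite /string_code ?foldl_rcons //= ?addnS //.
rewrite -/(string_code s) -/(string_code t) => -[e].
have O_gt0 : (0 < #|Omega|)%N by apply/card_gt0P; exists a.
have ea : enum_rank a = enum_rank b.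
  apply/val_inj => /=.
  by have := congr1 (modn^~ #|Omega|) e; rewrite !modnMDl !modn_small.
have es : string_code s = string_code t.
  by have := congr1 (divn^~ #|Omega|) e; rewrite !divnMDl // !divn_small // !addn0.
by rewrite (IHs _ es) (enum_rank_inj ea).
Qed.

Definition rec_enumerable (Omega : finType) (C : set (nat * seq Omega)) : Prop :=
  exists c : code, forall n sigma,
    C (n, sigma) <-> exists y, eval c [:: n; string_code sigma] y.

Definition prefix_of (Omega : Type) (alpha : nat -> Omega) (n : nat) : seq Omega :=
  mkseq alpha n.

Definition open_of (Omega : Type) (S : set (seq Omega)) : set (nat -> Omega) :=
  [set alpha | exists n, S (prefix_of alpha n)].

Notation infseq Omega := (g_sigma_algebraType (range (@open_of Omega))).

Record finprob (R : realType) (Omega : finType) := FinProb {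
  finprob_fun :> Omega -> R ;
  finprob_ge0 : forall a, 0 <= finprob_fun a ;
  finprob_sum1 : \sum_(a : Omega) finprob_fun a = 1
}.

Section BernoulliExistence.
Variables (R : realType) (Omega : alphabetType) (P : finprob R Omega).

(* Words index nested half-open subintervals of [0, 1[; the Bernoulli measure
   is the law of the sequence of letters coding a uniform random point. *)
Let F (a : Omega) : R := \sum_(b | (enum_rank b < enum_rank a)%N) P b.
Let step (s : R * R) (a : Omega) : R * R := (s.1 + s.2 * F a, s.2 * P a).
Let I (s : R * R) : set R := `[s.1, s.1 + s.2[%classic.
Let word (sigma : seq Omega) : R * R := foldl step (0, 1) sigma.

Let word_rcons sigma a : word (rcons sigma a) = step (word sigma) a.
Proof. by rewrite /word foldl_rcons. Qed.

Let word2 sigma : (word sigma).2 = \prod_(a <- sigma) P a.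
Proof.
elim/last_ind: sigma => [|s a IHs]; first by rewrite big_nil.
by rewrite word_rcons /= IHs -cats1 big_cat big_seq1.
Qed.

Let word2_ge0 sigma : 0 <= (word sigma).2.
Proof. by rewrite word2; apply: prodr_ge0 => a _; exact: finprob_ge0. Qed.

Let sum_le (A B : pred Omega) : subpred A B ->
  \sum_(c | A c) P c <= \sum_(c | B c) P c.
Proof.
move=> AB; rewrite big_mkcond [leRHS]big_mkcond; apply: ler_sum => c _.
case: ifPn => [/AB ->//|_]; case: ifP => // _; exact: finprob_ge0.
Qed.

Let FP a : F a + P a = \sum_(c | (enum_rank c <= enum_rank a)%N) P c.
Proof.
rewrite [RHS](bigD1 a)//= addrC; congr (_ + _).
apply: eq_bigl => c; rewrite ltn_neqAle andbC; congr (_ && ~~ _).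
by rewrite -(inj_eq enum_rank_inj).
Qed.

Let F_le (a b : Omega) : (enum_rank a < enum_rank b)%N -> F a + P a <= F b.
Proof. by move=> ab; rewrite FP; apply: sum_le => c /leq_ltn_trans; apply. Qed.

Let F_ge0 a : 0 <= F a.
Proof. by apply: sumr_ge0 => c _; exact: finprob_ge0. Qed.

Let F_le1 a : F a + P a <= 1.
Proof. by rewrite FP -(finprob_sum1 P); exact: sum_le. Qed.

Let I_step s a x : 0 <= s.2 -> I (step s a) x -> I s x.
Proof.
rewrite /I /= !in_itv /= => s0 /andP[h1 h2]; apply/andP; split.
  by apply: le_trans h1; rewrite lerDl mulr_ge0.
apply: (lt_le_trans h2); rewrite -addrA lerD2l -mulrDr.
by rewrite -[leRHS]mulr1 ler_wpM2l.
Qed.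

Let I_inj s a b x : 0 <= s.2 -> I (step s a) x -> I (step s b) x -> a = b.
Proof.
rewrite /I /= !in_itv /= => s0.
wlog ab : a b / (enum_rank a < enum_rank b)%N.
  move=> wl ha hb; have [||e] := ltngtP (enum_rank a) (enum_rank b).
  - by move=> h; exact: wl.
  - by move=> h; symmetry; exact: wl.
  - by apply/enum_rank_inj/val_inj.
move=> /andP[_ h2] /andP[h3 _].
have := le_lt_trans h3 h2; rewrite -addrA ltrD2l -mulrDr => h.
by have := lt_le_trans h (ler_wpM2l s0 (F_le ab)); rewrite ltxx.
Qed.

Let I_ex s x : I s x -> exists a, I (step s a) x.
Proof.
rewrite /I /= in_itv /= => /andP[h1 h2].
pose G i : R := \sum_(b : Omega | (enum_rank b < i)%N) P b.
have G1 : G #|Omega| = 1.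
  by rewrite /G -(finprob_sum1 P); apply: eq_bigl => b; rewrite ltn_ord.
have : exists i, x < s.1 + s.2 * G i by exists #|Omega|; rewrite G1 mulr1.
move=> /(ex_minnP (P := fun i => x < s.1 + s.2 * G i)) [m hm mmin].
case: m hm mmin => [|i] hm mmin.
  move: hm; rewrite /G big_pred0; last by move=> b; rewrite ltn0.
  by rewrite mulr0 addr0 ltNge h1.
have iO : (i < #|Omega|)%N.
  by apply: mmin; rewrite G1 mulr1.
exists (enum_val (Ordinal iO)).
have GF : F (enum_val (Ordinal iO)) = G i by rewrite /F enum_valK.
have GS : G i.+1 = G i + P (enum_val (Ordinal iO)).
  rewrite /G (bigD1 (enum_val (Ordinal iO)))/= ?enum_valK//= addrC; congr (_ + _).
  apply: eq_bigl => b; rewrite ltnS ltn_neqAle andbC; congr (_ && _).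
  by rewrite -(inj_eq enum_rank_inj) enum_valK.
rewrite in_itv /= GF -addrA -mulrDr -GS hm andbT leNgt.
by apply/negP => /mmin; rewrite ltnn.
Qed.

Let next (x : R) (s : R * R) : Omega := xget point [set a | I (step s a) x].
Let state (x : R) (n : nat) : R * R := iter n (fun s => step s (next x s)) (0, 1).
Let coding (x : R) : infseq Omega :=
  fun n => if x \in I (0, 1) then next x (state x n) else point.

Let I01 x : I (0, 1) x -> forall n, word (prefix_of (coding x) n) = state x n.
Proof.
move=> x01; elim=> [|n IHn] //=.
by rewrite /prefix_of mkseqS word_rcons -/(prefix_of _ _) IHn /coding mem_set.
Qed.

Let I_state x n : I (0, 1) x -> I (state x n) x.
Proof.
move=> x01; elim: n => [|n IHn] //=.
have [a ha] := I_ex IHn.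
by rewrite /next; case: xgetP => [b _ //|/(_ a)]; exact.
Qed.

Let I_word x sigma : I (word sigma) x ->
  I (0, 1) x /\ prefix_of (coding x) (size sigma) = sigma.
Proof.
elim/last_ind: sigma => [|s a IHs] //; rewrite word_rcons => ha.
have [x01 e] := IHs (I_step (word2_ge0 s) ha); split=> //.
rewrite size_rcons /prefix_of mkseqS -/(prefix_of _ _) e; congr rcons.
rewrite /coding mem_set // -I01 // e.
rewrite /next; case: xgetP => [b _ hb|/(_ a)]; last by [].
exact: I_inj (word2_ge0 s) hb ha.
Qed.

Let coding_preimage (S : set (seq Omega)) :
  coding @^-1` open_of S `&` I (0, 1) = \bigcup_(sigma in S) I (word sigma).
Proof.
apply/seteqP; split=> [x [[n Sn] x01]|x [sigma Ss /I_word [x01 e]]].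
  by exists (prefix_of (coding x) n) => //; rewrite I01 //; exact: I_state.
by split=> //; exists (size sigma); rewrite e.
Qed.

Let measurable_coding :
  measurable_fun setT (coding : measurableTypeR R -> infseq Omega).
Proof.
apply: (@measurability _ _ (measurableTypeR R) (infseq Omega) setT coding (range (@open_of Omega))) => //.
move=> _ [_ [S _ <-] <-]; rewrite setTI.
rewrite -[X in measurable X]setIT -(setUv (I (0, 1))) setIUr coding_preimage.
have mI s : measurable (I s : set (measurableTypeR R)) by exact: measurable_itv.
apply: measurableU.
  rewrite bigcup_mkcond; apply: countable_bigcupT_measurable => [|sigma].
    exact: countableP.
  by case: ifP.
rewrite (_ : _ `&` _ = if `[< open_of S (fun=> point) >] then ~` I (0, 1) else set0).
  by case: ifP => // _; exact: measurableC.
have out x : ~ I (0, 1) x -> coding x = fun=> point.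
  by move=> nx; apply/funext => n; rewrite /coding memNset.
apply/seteqP; case: ifPn => [/asboolP h|/asboolPn h]; split=> x //=.
- by case.
- by move=> nx; split=> //; rewrite out.
- by move=> [hx nx]; move: hx; rewrite out.
Qed.

Let mI01 : measurable (I (0, 1) : set (measurableTypeR R)).
Proof. exact: measurable_itv. Qed.

Let mu : {measure set (measurableTypeR R) -> \bar R} :=
  mrestr (@lebesgue_measure R) mI01.

Let law : set (infseq Omega) -> \bar R := pushforward mu coding.

Let law0 : law set0 = 0%E.
Proof. by rewrite /law /pushforward preimage_set0 measure0. Qed.

Let law_ge0 A : (0 <= law A)%E.
Proof. exact: measure_ge0. Qed.

Let law_sigma_additive : semi_sigma_additive law.
Proof.
exact: (@measure_semi_sigma_additive _ _ _
  (measure_function_pushforward__canonical__measure_function_Measure mu measurable_coding)).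
Qed.

HB.instance Definition _ := isMeasure.Build _ _ _ law law0 law_ge0 law_sigma_additive.

Let law_word sigma : law (open_of [set sigma]) = (\prod_(a <- sigma) P a)%:E.
Proof.
rewrite /law /pushforward /mu /= /mrestr coding_preimage bigcup_set1.
rewrite /I lebesgue_measure_itv /= lte_fin -word2 -EFinB addrAC subrr add0r.
rewrite ltrDl; case: ltP => // h; congr EFin; apply/eqP.
by rewrite eq_le word2_ge0.
Qed.

Let law_setT : law setT = 1%E.
Proof.
have := law_word [::]; rewrite big_nil => <-; congr law.
by apply/seteqP; split=> // x _; exists 0%N.
Qed.

HB.instance Definition _ := @Measure_isProbability.Build _ _ _ law law_setT.

Lemma bernoulli_exists : exists lambda : probability (infseq Omega) R,
  forall sigma, lambda (open_of [set sigma]) = (\prod_(a <- sigma) P a)%:E.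
Proof. by exists law. Qed.

End BernoulliExistence.

Definition bernoulli (R : realType) (Omega : alphabetType)
    (P : finprob R Omega) : probability (infseq Omega) R :=
  sval (cid (bernoulli_exists P)).

Lemma bernoulli_open_of (R : realType) (Omega : alphabetType)
    (P : finprob R Omega) (sigma : seq Omega) :
  bernoulli P (open_of [set sigma]) = (\prod_(a <- sigma) P a)%:E.
Proof. exact: (svalP (cid (bernoulli_exists P)) sigma). Qed.

Lemma measurable_open_of (Omega : alphabetType) (S : set (seq Omega)) :
  measurable (open_of S : set (infseq Omega)).
Proof. by apply: sub_sigma_algebra; exists S. Qed.

Section Randomness.
Variables (R : realType) (Omega : alphabetType) (P : finprob R Omega).

Definition computable_finprob : Prop := forall a : Omega, computable_real (P a).

Definition slice (C : set (nat * seq Omega)) (n : nat) : set (seq Omega) :=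
  [set sigma | C (n, sigma)].

(* A test is a subset of N^+ x Omega^*, as a set of pairs whose first component
   is positive. *)
Definition martin_lof_test (C : set (nat * seq Omega)) : Prop :=
  [/\ forall n sigma, C (n, sigma) -> (0 < n)%N,
      rec_enumerable C &
      forall n : nat, (0 < n)%N ->
        (bernoulli P (open_of (slice C n)) < (2%:R ^- n)%:E)%E].

(* The measures are finite, so [fine] loses nothing; the value of [f] at n = 0
   is irrelevant. *)
Definition schnorr_test (C : set (nat * seq Omega)) : Prop :=
  martin_lof_test C /\
  exists f : 2.-tuple nat -> rat, total_recursive_rat f /\
    forall n k : nat, (0 < n)%N ->
      `|fine (bernoulli P (open_of (slice C n))) - ratr (f [tuple n; k])|
        < 2%:R ^- k.

Definition passes (C : set (nat * seq Omega)) (alpha : nat -> Omega) : Prop :=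
  exists n : nat, (0 < n)%N /\ ~ open_of (slice C n) alpha.

Definition schnorr_random (alpha : nat -> Omega) : Prop :=
  forall C, schnorr_test C -> passes C alpha.

End Randomness.

(* Main.v *)
Require Import Defs.
From mathcomp Require Import all_boot all_order all_algebra.
From mathcomp Require Import all_classical all_reals all_analysis.
From mathcomp Require Import zify ring lra.

Set Implicit Arguments.
Unset Strict Implicit.
Unset Printing Implicit Defensive.

Import Order.TTheory GRing.Theory Num.Theory.
Import numFieldNormedType.Exports.

Local Open Scope classical_set_scope.
Local Open Scope ring_scope.

(* Fix a letter of probability [p].  The centred number of its occurrences among
   the first [k] letters has [2m]-th moment O(k^m), so it exceeds
   k^(1/2 + 1/m) with probability O(k^-2).  Sequences having such a deviation at
   some length [k >= C 2^n] therefore form an open set of measure less than 2^-n;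
   replacing [p] by rationals within 2^-k of it makes the deviation decidable, and
   the measure of the open set is computable, since lengths above [K] contribute
   O(1/K) while the remaining ones amount to a finite sum over coin tosses.  This
   is a Schnorr test, so a random sequence has no such deviation from some length
   on; with [m] large against 1/eps, the threshold is less than k/n whenever
   k >= n^(2+eps). *)

(** * Recursive functions *)

(* [F] is computable from the values of the functions in [s]; the abstract
   domain [X] stands for the variables in scope. *)
Definition recursive (X : Type) (s : seq (X -> nat)) (F : X -> nat) : Prop :=
  exists c : Defs.code, forall x, Defs.eval c [seq g x | g <- s] (F x).

(* The context [s] extended with one bound variable, listed first. *)
Definition bind (X : Type) (s : seq (X -> nat)) : seq (nat * X -> nat) :=
  fst :: [seq g \o snd | g <- s].

Section Recursive.
Local Open Scope nat_scope.

Lemma recursive_ext (X : Type) (s : seq (X -> nat)) (F G : X -> nat) :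
  F =1 G -> recursive s F -> recursive s G.
Proof. by move=> FG [c cF]; exists c => x; rewrite -FG. Qed.

Lemma recursive_var (X : Type) (s : seq (X -> nat)) (i : nat) :
  recursive s (nth (fun=> 0) s i).
Proof.
exists (Proj i) => x /=; elim: s i => [|g s IHs] [|i] //=.
Qed.

(** [Comp] feeds the code of [F] with one code per variable of [s], each computing that variable
    after the change of scope [h]. Weakening and composition are instances. *)
Lemma recursive_subst (X Y : Type) (s : seq (X -> nat)) (t : seq (Y -> nat))
    (h : Y -> X) (F : X -> nat) : recursive s F ->
  (forall i, i < size s -> recursive t (nth (fun=> 0) s i \o h)) ->
  recursive t (F \o h).
Proof.
move=> [c cF] st.
have [cs csP] : exists cs, forall y,
    all2P (fun c => Defs.eval c [seq g y | g <- t]) cs [seq g (h y) | g <- s].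
  clear cF; elim: s st => [|g s IHs] st; first by exists [::].
  have [cs csP] := IHs (fun i => st i.+1).
  by have [cg cgP] := st 0 isT; exists (cg :: cs) => y; split; [exact: cgP|].
by exists (Comp c cs) => y; exists [seq g (h y) | g <- s].
Qed.

Lemma recursive_bind (X : Type) (s : seq (X -> nat)) (F : X -> nat) :
  recursive s F -> recursive (bind s) (F \o snd).
Proof.
move=> /recursive_subst; apply=> i i_lt.
by have := recursive_var (bind s) i.+1; rewrite /bind /= (nth_map (fun=> 0)).
Qed.

Lemma recursive_comp1 (X : Type) (s : seq (X -> nat)) (H : nat -> nat)
    (F : X -> nat) :
  recursive [:: id] H -> recursive s F -> recursive s (fun x => H (F x)).
Proof. by move=> hH hF; apply: (recursive_subst (h := F) hH) => -[]. Qed.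

Lemma recursive_comp2 (X : Type) (s : seq (X -> nat)) (H : nat -> nat -> nat)
    (F G : X -> nat) :
  recursive [:: fst; snd] (fun u => H u.1 u.2) -> recursive s F ->
  recursive s G -> recursive s (fun x => H (F x) (G x)).
Proof.
by move=> hH hF hG; apply: (recursive_subst (h := fun x => (F x, G x)) hH)
  => -[|[]].
Qed.

(** Lets [recursive_prec] hand the whole context on to [Prec], behind the recursion bound. *)
Lemma eval_projections (j : nat) (v w : seq nat) :
  (forall i, nth 0 v i = nth 0 w (j + i)) ->
  all2P (fun c => Defs.eval c w) (map Proj (iota j (size v))) v.
Proof.
elim: v j => //= y v IHv j vw; split; first by have := vw 0; rewrite addn0.
by apply: IHv => i; have := vw i.+1; rewrite addSnnS.
Qed.

Lemma recursive_prec (X : Type) (s : seq (X -> nat)) (F N : X -> nat)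
    (G : nat -> nat -> X -> nat) :
  recursive s F -> recursive s N ->
  recursive (bind (bind s)) (fun u => G u.1 u.2.1 u.2.2) ->
  recursive s (fun x => nat_rect _ (F x) (fun m z => G m z x) (N x)).
Proof.
move=> [cF FP] [cN NP] [cG GP].
exists (Comp (Prec cF cG) (cN :: map Proj (iota 0 (size s)))) => x.
exists (N x :: [seq g x | g <- s]); split=> /=.
  split; first exact: NP.
  by rewrite -(size_map (fun g => g x)); apply: eval_projections.
elim: (N x) => [|n IHn] /=; first exact: FP.
eexists; split; first exact: IHn.
have := GP (n, (nat_rect _ (F x) (fun m z => G m z x) n, x)).
by rewrite /= -!map_comp; apply.
Qed.

Lemma recursive_const (X : Type) (s : seq (X -> nat)) (n : nat) :
  recursive s (fun=> n).
Proof.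
elim: n => [|n [c cP]]; first by exists Zero.
by exists (Comp Succ [:: c]) => x; exists [:: n].
Qed.

Lemma recursive_succ (X : Type) (s : seq (X -> nat)) (F : X -> nat) :
  recursive s F -> recursive s (fun x => (F x).+1).
Proof. by apply: (@recursive_comp1 _ _ succn); exists Succ. Qed.

Ltac recursive_var := match goal with |- recursive ?s _ => first
  [ exact (recursive_var s 0) | exact (recursive_var s 1)
  | exact (recursive_var s 2) | exact (recursive_var s 3)
  | exact (recursive_var s 4) | exact (recursive_var s 5)
  | exact (recursive_var s 6) ] end.

Lemma recursive_pred (X : Type) (s : seq (X -> nat)) (F : X -> nat) :
  recursive s F -> recursive s (fun x => (F x).-1).
Proof.
apply: recursive_comp1.
apply: (recursive_ext (F := nat_rect _ 0 (fun m _ => m))); first by case.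
by apply: (recursive_prec (F := fun=> 0) (G := fun m _ _ => m));
  [exact: recursive_const|recursive_var|recursive_var].
Qed.

Lemma recursive_add (X : Type) (s : seq (X -> nat)) (F G : X -> nat) :
  recursive s F -> recursive s G -> recursive s (fun x => F x + G x).
Proof.
apply: recursive_comp2.
apply: (recursive_ext (F := fun u => nat_rect _ u.1 (fun _ z => z.+1) u.2)).
  by move=> [m n] /=; elim: n => [|n /= ->]; rewrite ?addn0 ?addnS.
apply: (recursive_prec (G := fun _ z _ => z.+1)); try recursive_var.
by apply: recursive_succ; recursive_var.
Qed.

Lemma recursive_mul (X : Type) (s : seq (X -> nat)) (F G : X -> nat) :
  recursive s F -> recursive s G -> recursive s (fun x => F x * G x).
Proof.
apply: recursive_comp2.
apply: (recursive_ext (F := fun u => nat_rect _ 0 (fun _ z => z + u.1) u.2)).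
  by move=> [m n] /=; elim: n => [|n /= ->]; rewrite ?muln0 // mulnS addnC.
apply: (recursive_prec (F := fun=> 0)
  (G := fun (_ z : nat) (u : nat * nat) => z + u.1)).
- exact: recursive_const.
- recursive_var.
- by apply: recursive_add; recursive_var.
Qed.

Lemma recursive_sub (X : Type) (s : seq (X -> nat)) (F G : X -> nat) :
  recursive s F -> recursive s G -> recursive s (fun x => F x - G x).
Proof.
apply: recursive_comp2.
apply: (recursive_ext (F := fun u => nat_rect _ u.1 (fun _ z => z.-1) u.2)).
  by move=> [m n] /=; elim: n => [|n /= ->]; rewrite ?subn0 // subnS.
apply: (recursive_prec (G := fun _ z _ => z.-1)); try recursive_var.
by apply: recursive_pred; recursive_var.
Qed.

Lemma recursive_exp (X : Type) (s : seq (X -> nat)) (F G : X -> nat) :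
  recursive s F -> recursive s G -> recursive s (fun x => F x ^ G x).
Proof.
apply: recursive_comp2.
apply: (recursive_ext (F := fun u => nat_rect _ 1 (fun _ z => z * u.1) u.2)).
  by move=> [m n] /=; elim: n => [|n /= ->]; rewrite ?expn0 // expnSr.
apply: (recursive_prec (F := fun=> 1)
  (G := fun (_ z : nat) (u : nat * nat) => z * u.1)).
- exact: recursive_const.
- recursive_var.
- by apply: recursive_mul; recursive_var.
Qed.

Lemma recursive_leq (X : Type) (s : seq (X -> nat)) (F G : X -> nat) :
  recursive s F -> recursive s G ->
  recursive s (fun x => (F x <= G x) : nat).
Proof.
move=> hF hG; apply: (recursive_ext (F := fun x => 1 - (F x - G x))).
  by move=> x; rewrite /leq; case: (F x - G x) => [|[]].
by apply: recursive_sub; [exact: recursive_const|exact: recursive_sub].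
Qed.

Lemma recursive_and (X : Type) (s : seq (X -> nat)) (F G : X -> bool) :
  recursive s F -> recursive s G ->
  recursive s (fun x => (F x && G x) : nat).
Proof.
move=> hF hG; apply: (recursive_ext (F := fun x => F x * G x)).
  by move=> x; rewrite mulnb.
exact: recursive_mul.
Qed.

Lemma recursive_if (X : Type) (s : seq (X -> nat)) (B : X -> bool)
    (F G : X -> nat) : recursive s B -> recursive s F -> recursive s G ->
  recursive s (fun x => if B x then F x else G x).
Proof.
move=> hB hF hG.
apply: (recursive_ext (F := fun x => B x * F x + (1 - B x) * G x)).
  by move=> x; case: (B x); rewrite !(mul1n, mul0n, addn0).
apply: recursive_add; apply: recursive_mul => //.
by apply: recursive_sub => //; exact: recursive_const.
Qed.

Lemma recursive_eq (X : Type) (s : seq (X -> nat)) (F G : X -> nat) :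
  recursive s F -> recursive s G ->
  recursive s (fun x => (F x == G x) : nat).
Proof.
move=> hF hG.
apply: (recursive_ext (F := fun x => ((F x <= G x) && (G x <= F x) : nat))).
  by move=> x; rewrite -eqn_leq.
by apply: recursive_and; exact: recursive_leq.
Qed.

Lemma recursive_big (X : Type) (s : seq (X -> nat)) (idx : nat)
    (op : Monoid.law idx) (N : X -> nat) (G : nat -> X -> nat) :
  recursive [:: fst; snd] (fun u => op u.1 u.2) ->
  recursive s N -> recursive (bind s) (fun u => G u.1 u.2) ->
  recursive s (fun x => \big[op/idx]_(i < N x) G i x).
Proof.
move=> hop hN hG.
apply: (recursive_ext
  (F := fun x => nat_rect _ idx (fun m z => op z (G m x)) (N x))).
  move=> x; elim: (N x) => [|n /= ->]; first by rewrite big_ord0.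
  by rewrite big_ord_recr.
apply: (recursive_prec (F := fun=> idx) (G := fun m z x => op z (G m x))) => //.
  exact: recursive_const.
apply: recursive_comp2 => //; first by recursive_var.
(* In the recursion step the accumulator stands between the counter and the context; [G] has to skip
   it. *)
apply: (recursive_subst (h := fun u => (u.1, u.2.2)) hG) => -[|i] i_lt.
  by recursive_var.
have := recursive_var (bind (bind s)) i.+2; rewrite /bind /= -map_comp.
by rewrite /bind /= size_map in i_lt; rewrite !(nth_map (fun=> 0)).
Qed.

Lemma recursive_sum (X : Type) (s : seq (X -> nat)) (N : X -> nat)
    (G : nat -> X -> nat) :
  recursive s N -> recursive (bind s) (fun u => G u.1 u.2) ->
  recursive s (fun x => \sum_(i < N x) G i x).
Proof. by apply: recursive_big; apply: recursive_add; recursive_var. Qed.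

Lemma recursive_prod (X : Type) (s : seq (X -> nat)) (N : X -> nat)
    (G : nat -> X -> nat) :
  recursive s N -> recursive (bind s) (fun u => G u.1 u.2) ->
  recursive s (fun x => \prod_(i < N x) G i x).
Proof. by apply: recursive_big; apply: recursive_mul; recursive_var. Qed.

Lemma recursive_iter (X : Type) (s : seq (X -> nat)) (N F : X -> nat)
    (h : nat -> nat) :
  recursive s N -> recursive s F -> recursive [:: id] h ->
  recursive s (fun x => iter (N x) h (F x)).
Proof.
move=> hN hF hh.
apply: (recursive_ext (F := fun x => nat_rect _ (F x) (fun _ z => h z) (N x))).
  by move=> x; elim: (N x) => //= n ->.
apply: (recursive_prec (G := fun _ z _ => h z)) => //.
by apply: recursive_comp1 => //; recursive_var.
Qed.

(** The quotient counts the positive multiples of [d] up to [m]. The factor [0 < d] restores the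
    convention that division by 0 gives 0, where the sum would give [m]. *)
Lemma divn_sum (m d : nat) :
  m %/ d = (0 < d) * \sum_(i < m) (i.+1 * d <= m).
Proof.
case: d => [|d]; first by rewrite divn0.
rewrite mul1n -[in LHS](card_ord (m %/ d.+1)) -sum1_card.
rewrite (big_ord_widen m (fun=> 1)) ?leq_div // big_mkcond /=.
by apply: eq_bigr => i _; rewrite leq_divRL //; case: leqP.
Qed.

Lemma recursive_div (X : Type) (s : seq (X -> nat)) (F G : X -> nat) :
  recursive s F -> recursive s G -> recursive s (fun x => F x %/ G x).
Proof.
apply: recursive_comp2.
apply: recursive_ext => [u|]; first by rewrite divn_sum.
apply: recursive_mul.
  apply: (recursive_leq (F := fun=> 1)); last by recursive_var.
  exact: recursive_const.
apply: (recursive_sum (G := fun i u => i.+1 * u.2 <= u.1 : nat)).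
  by recursive_var.
apply: recursive_leq; last by recursive_var.
by apply: recursive_mul; [apply: recursive_succ|]; recursive_var.
Qed.

Lemma recursive_mod (X : Type) (s : seq (X -> nat)) (F G : X -> nat) :
  recursive s F -> recursive s G -> recursive s (fun x => F x %% G x).
Proof.
move=> hF hG; apply: (recursive_ext (F := fun x => F x - F x %/ G x * G x)).
  by move=> x; rewrite {1}(divn_eq (F x) (G x)) addKn.
by apply: recursive_sub => //; apply: recursive_mul => //; exact: recursive_div.
Qed.

End Recursive.

(** * Counting the letters of a word from its code *)

Section StringCode.
Local Open Scope nat_scope.

(* Iterating [m |-> (m - 1) / b] strips the letters of a word off its code from
   the right, until it reaches the fixed point 0. *)
Definition strip (b m : nat) : nat := m.-1 %/ b.

(** On the code of a word over [b] letters, the number of letters whose rank satisfies [q]. Running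
    [c] rounds is enough, as a word is no longer than its code; the guard discards the rounds after
    the word is exhausted. *)
Definition digit_count (b : nat) (q : nat -> bool) (c : nat) : nat :=
  \sum_(i < c)
    ((0 < iter i (strip b) c) && q ((iter i (strip b) c).-1 %% b)).

Lemma recursive_digit_count (b : nat) (q : nat -> bool) :
  recursive [:: id] q -> recursive [:: id] (digit_count b q).
Proof.
move=> hq; apply: (recursive_sum (G := fun i c =>
  (0 < iter i (strip b) c) && q ((iter i (strip b) c).-1 %% b) : nat)).
  exact: (recursive_var [:: id] 0).
have h : recursive (bind [:: id]) (fun u : nat * nat => iter u.1 (strip b) u.2).
  apply: recursive_iter.
  - exact: (recursive_var _ 0).
  - exact: (recursive_var _ 1).
  - apply: recursive_div; last exact: recursive_const.
    by apply: recursive_pred; exact: (recursive_var [:: id] 0).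
apply: recursive_and.
  by apply: recursive_leq => //; exact: recursive_const.
apply: (recursive_comp1 (H := q)) => //; apply: recursive_mod.
  exact: recursive_pred.
exact: recursive_const.
Qed.

Variable Omega : finType.
Local Notation b := #|Omega|.

Lemma string_code_rcons (s : seq Omega) (a : Omega) :
  string_code (rcons s a) = (string_code s * b + enum_rank a).+1.
Proof. by rewrite /string_code foldl_rcons addnS. Qed.

Lemma size_string_code (s : seq Omega) : size s <= string_code s.
Proof.
elim/last_ind: s => // s a IHs; rewrite size_rcons string_code_rcons ltnS.
rewrite (leq_trans IHs) // (leq_trans _ (leq_addr _ _)) // leq_pmulr //.
by apply/card_gt0P; exists a.
Qed.

Lemma digit_count_string_code (q : nat -> bool) (s : seq Omega) :
  digit_count b q (string_code s) = count (fun a => q (enum_rank a)) s.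
Proof.
(* Stripping one letter uses up one round but lowers the code by an unrelated amount, so the number
   of rounds is freed from the code before the induction. *)
suff count_upto N : size s <= N -> \sum_(i < N)
    ((0 < iter i (strip b) (string_code s)) &&
     q ((iter i (strip b) (string_code s)).-1 %% b)) =
    count (fun a => q (enum_rank a)) s.
  exact: count_upto (size_string_code s).
elim/last_ind: s N => [|s a IHs] N.
  move=> _; rewrite big1 // => i _.
  rewrite [string_code _]/= (_ : iter i _ 0 = 0) //.
  by elim: (val i) => //= n ->; rewrite /strip div0n.
rewrite size_rcons; case: N => // N sN.
have ab := ltn_ord (enum_rank a); have b0 : 0 < b by apply: leq_trans ab.
have stripS i : iter i.+1 (strip b) (string_code (rcons s a)) =
    iter i (strip b) (string_code s).
  rewrite iterSr string_code_rcons; congr (iter i _ _).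
  by rewrite /strip /= divnMDl // divn_small // addn0.
rewrite big_ord_recl [iter ord0 _ _]/= string_code_rcons /= modnMDl.
rewrite modn_small // -cats1 count_cat /= addn0 [RHS]addnC; congr (_ + _).
rewrite -(IHs N sN); apply: eq_bigr => i _; rewrite -string_code_rcons.
exact: (congr1 (fun m => ((0 < m) && q (m.-1 %% b)) : nat) (stripS i)).
Qed.

End StringCode.

(** * Coin tossing *)

Lemma normr_expr_double (R : realType) (x : R) (m : nat) :
  `|x| ^+ m.*2 = x ^+ m.*2.
Proof. by rewrite -normrX ger0_norm // exprn_even_ge0 // odd_double. Qed.

Section CoinTossing.
Variable R : realType.
Implicit Types (p q : R) (K : nat) (h g : seq bool -> R).

(** Expectation over [K] independent tosses with probability [p] of heads. The finite recursion
    involves no measure, so the true bias and its rational approximations are treated alike. *)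
Fixpoint expect p K h : R :=
  if K is K'.+1 then
    p * expect p K' (fun s => h (true :: s)) +
    (1 - p) * expect p K' (fun s => h (false :: s))
  else h [::].

Lemma eq_expect p K h g :
  (forall s, size s = K -> h s = g s) -> expect p K h = expect p K g.
Proof.
elim: K h g => [|K IHK] h g hg /=; first exact: hg.
by congr (_ * _ + _ * _); apply: IHK => s sK; apply: hg; rewrite /= sK.
Qed.

Lemma expectD p K h g :
  expect p K (fun s => h s + g s) = expect p K h + expect p K g.
Proof. by elim: K h g => [//|K IHK] h g /=; rewrite !IHK; ring. Qed.

Lemma expectZ p K (c : R) h :
  expect p K (fun s => c * h s) = c * expect p K h.
Proof. by elim: K h => [//|K IHK] h /=; rewrite !IHK; ring. Qed.

Lemma expect_cst p K (c : R) : expect p K (fun=> c) = c.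
Proof. by elim: K => [//|K /= ->]; ring. Qed.

(** The last toss is never read: once the first [K] are peeled off, its two weights add up to 1. *)
Lemma expect_take p K h : expect p K.+1 (fun s => h (take K s)) = expect p K h.
Proof.
elim: K h => [|K IHK] h; first by rewrite /=; ring.
rewrite -[RHS]/(p * expect p K (fun s => h (true :: s)) +
  (1 - p) * expect p K (fun s => h (false :: s))).
by rewrite -!IHK.
Qed.

Lemma le_expect p K h g : 0 <= p <= 1 ->
  (forall s, size s = K -> h s <= g s) -> expect p K h <= expect p K g.
Proof.
move=> /andP[p0 p1]; elim: K h g => [|K IHK] h g hg /=; first exact: hg.
by apply: lerD; apply: ler_wpM2l; rewrite ?subr_ge0 //; apply: IHK => s sK;
  apply: hg; rewrite /= sK.
Qed.

Lemma expect_itv p K h : 0 <= p <= 1 -> (forall s, 0 <= h s <= 1) ->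
  0 <= expect p K h <= 1.
Proof.
move=> p01 h01; apply/andP; split.
- rewrite -[leLHS](expect_cst p K); apply: le_expect => // s _.
  by case/andP: (h01 s).
- rewrite -[leRHS](expect_cst p K); apply: le_expect => // s _.
  by case/andP: (h01 s).
Qed.

(** Each toss costs at most [|p - q|]: changing the bias of the first toss multiplies [p - q] by a
    difference of two conditional expectations in [0, 1], and the later tosses contribute a convex
    combination of induction hypotheses. *)
Lemma expect_lipschitz p q K h : 0 <= p <= 1 -> 0 <= q <= 1 ->
  (forall s, 0 <= h s <= 1) ->
  `|expect p K h - expect q K h| <= K%:R * `|p - q|.
Proof.
move=> p01 q01; elim: K h => [|K IHK] h h01 /=.
  by rewrite subrr normr0 mul0r.
set a := expect p K _; set b := expect p K _.
set c := expect q K _; set d := expect q K _.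
have ac : `|a - c| <= K%:R * `|p - q| by apply: IHK.
have bd : `|b - d| <= K%:R * `|p - q| by apply: IHK.
have /andP[c0 c1] : 0 <= c <= 1 by apply: expect_itv.
have /andP[d0 d1] : 0 <= d <= 1 by apply: expect_itv.
have -> : p * a + (1 - p) * b - (q * c + (1 - q) * d) =
    p * (a - c) + (1 - p) * (b - d) + (p - q) * (c - d) by ring.
have /andP[p0 p1] := p01.
rewrite -natr1 (mulrDl _ _ `|p - q|) mul1r; apply: le_trans (ler_normD _ _) _.
apply: lerD; last first.
  by rewrite normrM ler_piMr // ler_norml; apply/andP; split; lra.
apply: le_trans (ler_normD _ _) _; rewrite !normrM (ger0_norm p0).
rewrite (ger0_norm (_ : 0 <= 1 - p)) ?subr_ge0 //.
apply: (@le_trans _ _ (p * (K%:R * `|p - q|) + (1 - p) * (K%:R * `|p - q|))).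
  by apply: lerD; apply: ler_wpM2l; rewrite ?subr_ge0.
by rewrite -mulrDl addrC subrK mul1r.
Qed.

Lemma sum_double (F : nat -> R) n :
  \sum_(i < n.*2) F i = \sum_(i < n) (F i.*2 + F i.*2.+1).
Proof.
elim: n => [|n IHn]; first by rewrite !big_ord0.
by rewrite doubleS !big_ord_recr /= IHn addrA.
Qed.

Definition bits (K w : nat) : seq bool := mkseq (fun j => odd (w %/ 2 ^ j)) K.

Lemma bits_double (b : bool) K w : bits K.+1 (b + w.*2) = b :: bits K w.
Proof.
rewrite /bits /mkseq /= expn0 divn1 oddD odd_double addbF oddb; congr (_ :: _).
rewrite (iotaDl 1 0) -map_comp; apply: eq_map => j /=.
rewrite add1n expnS divnMA -muln2 addnC divnMDl //.
by rewrite (divn_small (m := b)) ?addn0 //; case: b.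
Qed.

(** Indexes the outcomes by numbers below [2 ^ K], giving a sum that a recursive function can
    evaluate. The lowest bit is the first toss, so the recursion of [expect] separates odd from even
    indices. *)
Lemma expect_bits p K h : expect p K h =
  \sum_(w < 2 ^ K) h (bits K w) * \prod_(b <- bits K w) (if b then p else 1 - p).
Proof.
elim: K h => [|K IHK] h.
  by rewrite expn0 big_ord1 /= big_nil mulr1.
rewrite expnS mul2n (sum_double (fun w => h (bits K.+1 w) *
   \prod_(b <- bits K.+1 w) (if b then p else 1 - p))) /= !IHK !mulr_sumr.
rewrite -big_split; apply: eq_bigr => w _ /=.
rewrite -[in RHS](add0n w.*2) -[in RHS](add1n w.*2).
by rewrite (bits_double false) (bits_double true) !big_cons; ring.
Qed.

(** Dominates every lower power, odd ones included, by an even moment: the bound is 1 when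
    [|x| <= 1] and the top power otherwise. *)
Lemma le_expr_1D (x : R) (j m : nat) : (j <= m.*2)%N ->
  `|x| ^+ j <= 1 + x ^+ m.*2.
Proof.
move=> jm; have e : x ^+ m.*2 = `|x| ^+ m.*2 by rewrite normr_expr_double.
have [x1|/ltW x1] := leP `|x| 1.
  by rewrite (le_trans (exprn_ile1 _ (normr_ge0 x) x1)) // lerDl e exprn_ge0.
by rewrite e (le_trans (ler_weXn2l x1 jm)) // lerDr.
Qed.

(** Binomial expansion with the first two terms kept exactly. In the others [x] has exponent at most
    [2m], and their coefficients sum to at most [2 ^ (2m + 2)]. The term linear in [y] is kept
    because it will average to zero. *)
Lemma exprD_near (x y : R) (m : nat) : `|y| <= 1 ->
  (x + y) ^+ m.+1.*2 <=
    x ^+ m.+1.*2 + m.+1.*2%:R * x ^+ m.*2.+1 * y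
    + 4 ^+ m.+1 * (1 + x ^+ m.*2).
Proof.
move=> y1; rewrite doubleS exprDn big_ord_recl /= subn0 expr0 mulr1 bin0 mulr1n.
rewrite -addrA lerD2l big_ord_recl /= bin1 expr1 subn1 /= -mulr_natl mulrA.
rewrite lerD2l.
have s0 : 0 <= 1 + x ^+ m.*2 by rewrite addr_ge0 // exprn_even_ge0 // odd_double.
apply: (@le_trans _ _
  (\sum_(i < m.*2.+1) 'C(m.*2.+2, i.+2)%:R * (1 + x ^+ m.*2))).
  apply: ler_sum => i _; rewrite -mulr_natl ler_wpM2l //.
  apply: le_trans (ler_norm _) _; rewrite normrM !normrX.
  rewrite /bump /= !add1n !subSS.
  rewrite -[leRHS]mulr1 ler_pM ?exprn_ge0 // ?exprn_ile1 //.
  by rewrite le_expr_1D // leq_subr.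
rewrite -mulr_suml ler_wpM2r // -natr_sum -natrX ler_nat.
have -> : (4 ^ m.+1 = (1 + 1) ^ m.*2.+2)%N by rewrite -doubleS -mul2n expnM.
rewrite expnDn 2!big_ord_recl /= /bump /=.
rewrite -[leqLHS]add0n addnA leq_add // eq_leq //.
by apply: eq_bigr => i _; rewrite !exp1n !muln1.
Qed.

Definition dev p (s : seq bool) : R := (count id s)%:R - (size s)%:R * p.

(** A further toss adds to [dev] an independent quantity of mean zero and size at most 1. By
    [exprD_near] the moment of order [2m + 2] then grows by a constant times 1 plus the moment of
    order [2m], that is by O(K^m) per toss. *)
Lemma moment_bound (m : nat) : exists C : nat, forall p K, 0 <= p <= 1 ->
  expect p K (fun s => dev p s ^+ m.*2) <= C%:R * K.+1%:R ^+ m.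
Proof.
elim: m => [|m [C CP]].
  by exists 1%N => p K _; rewrite expect_cst expr0 mulr1.
(* One toss adds at most [4 ^ (m + 1) * (1 + C (K + 1) ^ m)]; the 1 is absorbed into [(K + 1) ^ m],
   whence [C.+1]. *)
exists (4 ^ m.+1 * C.+1)%N => p K p01; have /andP[p0 p1] := p01.
elim: K => [|K IHK].
  by rewrite /= /dev /= mul0r subrr expr1n mulr1 doubleS expr0n ler0n.
have cons b s : dev p (b :: s) = dev p s + (b%:R - p).
  by rewrite /dev /= -natr1 natrD; ring.
set c := 4 ^+ m.+1 : R.
apply: (@le_trans _ _
  (expect p K (fun s => dev p s ^+ m.+1.*2 + c * (1 + dev p s ^+ m.*2)))).
  pose up b s := dev p s ^+ m.+1.*2 + m.+1.*2%:R * dev p s ^+ m.*2.+1 * (b%:R - p)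
    + c * (1 + dev p s ^+ m.*2).
  apply: (@le_trans _ _
    (p * expect p K (up true) + (1 - p) * expect p K (up false))).
    rewrite /=; apply: lerD; apply: ler_wpM2l; rewrite ?subr_ge0 //;
      apply: le_expect => // s _; rewrite cons; apply: exprD_near;
      by rewrite ler_norml /=; apply/andP; split; lra.
  (* The linear terms cancel, since [p (1 - p) + (1 - p) (0 - p) = 0]. *)
  rewrite -!expectZ -expectD le_eqVlt; apply/orP; left; apply/eqP.
  by apply: eq_expect => s _; rewrite /up /=; ring.
rewrite expectD expectZ expectD expect_cst.
have K1 : 1 <= K.+1%:R ^+ m :> R by rewrite exprn_ege1 // ler1n.
apply: (@le_trans _ _ ((4 ^ m.+1 * C.+1)%:R * K.+1%:R ^+ m.+1
    + c * (K.+1%:R ^+ m + C%:R * K.+1%:R ^+ m))).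
  apply: lerD => //; rewrite ler_wpM2l ?exprn_ge0 //; apply: lerD => //.
  exact: CP.
rewrite natrM natrX -/c -!natr1.
have -> : c * (C%:R + 1) * (K%:R + 1) ^+ m.+1
  + c * ((K%:R + 1) ^+ m + C%:R * (K%:R + 1) ^+ m)
  = c * (C%:R + 1) * ((K%:R + 1) ^+ m * (K%:R + 1 + 1)) by rewrite exprSr; ring.
apply: ler_wpM2l; first by rewrite mulr_ge0 ?exprn_ge0 ?addr_ge0.
rewrite exprSr ler_wpM2r ?addr_ge0 // lerXn2r ?nnegrE ?addr_ge0 //.
by rewrite lerDl.
Qed.

(** Markov's inequality for the moment of order [2m], which is O(K^m), at the threshold
    [K ^ (m + 2)]. Centring at [K q] instead of [K p] shifts the deviation by at most 1. *)
Lemma deviation_bound (m : nat) : exists C : nat, forall p q K,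
  0 <= p <= 1 -> (0 < K)%N -> K%:R * `|q - p| <= 1 ->
  expect p K (fun s =>
    (K%:R ^+ m.+2 <= ((count id s)%:R - K%:R * q) ^+ m.*2)%R%:R)
    <= C%:R / K%:R ^+ 2.
Proof.
(* The factor [4 ^ m] comes from [(|x| + 1) ^ (2m) <= 4 ^ m (1 + x ^ (2m))], the factor [2 ^ m] from
   [K + 1 <= 2 K]. *)
have [C CP] := moment_bound m; exists (4 ^ m * (1 + C * 2 ^ m))%N.
move=> p q K p01 K0 qp; have K0' : 0 < K%:R :> R by rewrite ltr0n.
have K1 : 1 <= K%:R :> R by rewrite ler1n.
rewrite -(ler_pM2l (_ : 0 < K%:R ^+ m.+2)) ?exprn_gt0 // -expectZ.
apply: (@le_trans _ _ (expect p K (fun s => 4 ^+ m * (1 + dev p s ^+ m.*2)))).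
  apply: le_expect => // s sK.
  have d0 : 0 <= dev p s ^+ m.*2 by rewrite exprn_even_ge0 // odd_double.
  case: (boolP (_ ^+ m.+2 <= _)) => [big|_] /=; last first.
    by rewrite mulr0n mulr0 mulr_ge0 ?exprn_ge0 ?addr_ge0.
  rewrite mulr1n mulr1; apply: le_trans big _.
  have -> : (count id s)%:R - K%:R * q = dev p s + K%:R * (p - q).
    by rewrite /dev sK; ring.
  set x := dev p s; set y := K%:R * _.
  have y1 : `|y| <= 1 by rewrite /y normrM ger0_norm // distrC.
  have e : x ^+ m.*2 = `|x| ^+ m.*2 by rewrite normr_expr_double.
  rewrite -[leLHS]normr_expr_double.
  have -> : 4 ^+ m = 2 ^+ m.*2 :> R by rewrite -mul2n exprM; congr (_ ^+ m); ring.
  have [x1|/ltW x1] := leP `|x| 1.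
    apply: (@le_trans _ _ (2 ^+ m.*2)).
      rewrite lerXn2r ?nnegrE //; apply: le_trans (ler_normD _ _) _; lra.
    by rewrite ler_peMr ?exprn_ge0 // lerDl.
  apply: (@le_trans _ _ (2 ^+ m.*2 * x ^+ m.*2)).
    rewrite e -exprMn lerXn2r ?nnegrE //.
    by apply: le_trans (ler_normD _ _) _; lra.
  by rewrite ler_wpM2l ?exprn_ge0 // lerDr.
rewrite expectZ expectD expect_cst.
have -> : K%:R ^+ m.+2 * ((4 ^ m * (1 + C * 2 ^ m))%:R / K%:R ^+ 2) =
    4 ^+ m * (K%:R ^+ m + C%:R * (2 * K%:R) ^+ m) :> R.
  rewrite natrM natrD natrM !natrX -addn2 exprD exprMn.
  by field; rewrite gt_eqF.
apply: ler_wpM2l; first by rewrite exprn_ge0.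
apply: lerD; first by rewrite exprn_ege1.
apply: le_trans (CP p K p01) _; apply: ler_wpM2l => //.
rewrite lerXn2r ?nnegrE ?mulr_ge0 // -natr1; lra.
Qed.

End CoinTossing.

(** * Toss sequences that reach a bad number of heads *)

Section Hitting.
Variable bad : nat -> nat -> bool.

Definition hit (lo : nat) (s : seq bool) : bool :=
  has (fun k => bad k (count id (take k s))) (index_iota lo (size s).+1).

Lemma hitP lo s : reflect
  (exists k, [/\ (lo <= k)%N, (k <= size s)%N & bad k (count id (take k s))])
  (hit lo s).
Proof.
apply: (iffP hasP) => [[k]|[k [lok ks kbad]]]; last first.
  by exists k; rewrite // mem_index_iota lok.
by rewrite mem_index_iota ltnS => /andP[lok ks] kbad; exists k.
Qed.

Lemma hit_take lo K s : (K <= size s)%N -> hit lo (take K s) -> hit lo s.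
Proof.
move=> Ks /hitP[k [lok]]; rewrite size_takel // => kK.
by rewrite take_takel // => kbad; apply/hitP; exists k; rewrite (leq_trans kK).
Qed.

Lemma hit_recent lo s : hit lo s ->
  hit lo (take (size s).-1 s) || bad (size s) (count id s).
Proof.
move=> /hitP[k [lok]]; rewrite leq_eqVlt => /predU1P[->|ks kbad].
  by rewrite take_size => ->; rewrite orbT.
have kK : (k <= (size s).-1)%N by rewrite -ltnS (ltn_predK ks).
apply/orP; left; apply/hitP; exists k; split=> //.
  by rewrite size_takel // leq_pred.
by rewrite take_takel.
Qed.

Variables (R : realType) (p : R) (lo : nat).
Hypothesis p01 : 0 <= p <= 1.

Let u K : R := expect p K (fun s => (hit lo s)%:R).

Lemma expect_hit0 K : (K < lo)%N -> u K = 0.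
Proof.
move=> Klo; rewrite -[RHS](expect_cst p K); apply: eq_expect => s sK.
case: hitP => // -[k []]; rewrite sK => lok kK.
by have := leq_trans Klo (leq_trans lok kK); rewrite ltnn.
Qed.

(** Union bound over the lengths above [K]: a first hit at length [L] makes the count bad there, and
    the bounds [C / L ^ 2] have a tail of at most [C / K]. *)
Lemma expect_hit_tail (C : nat) :
  (forall K, (0 < K)%N ->
     expect p K (fun s => (bad K (count id s))%:R) <= C%:R / K%:R ^+ 2) ->
  forall K j, (0 < K)%N -> u (K + j) <= u K + C%:R / K%:R.
Proof.
move=> badC K j K0.
(* Telescoping form of the tail, by [1 / (L + 1) ^ 2 <= 1 / L - 1 / (L + 1)]. *)
suff : u (K + j) <= u K + (C%:R / K%:R - C%:R / (K + j)%:R).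
  move=> /le_trans; apply; rewrite lerD2l gerDl oppr_le0.
  by rewrite divr_ge0.
elim: j => [|j IHj]; first by rewrite addn0 subrr addr0.
rewrite addnS; set L := (K + j)%N in IHj *.
have L0 : (0 < L)%N by rewrite addn_gt0 K0.
have uL : u L.+1 <= u L + C%:R / L.+1%:R ^+ 2.
  apply: le_trans (lerD (lexx _) (badC L.+1 isT)).
  rewrite /u -(expect_take p L) -expectD; apply: le_expect => // s sL.
  case: (boolP (hit lo s)) => [/hit_recent|_]; last by rewrite addr_ge0.
  rewrite sL /= => /orP[->|->]; first by rewrite lerDl.
  by rewrite lerDr.
apply: (le_trans uL); apply: le_trans (lerD IHj (lexx _)) _.
rewrite -!addrA lerD2l lerD2l.
have l0 : 0 < L%:R :> R by rewrite ltr0n.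
rewrite -natr1 in l0 *.
have -> : C%:R / (L%:R + 1) = C%:R / L%:R - C%:R / (L%:R * (L%:R + 1)) :> R.
  by field; rewrite ?gt_eqF // addr_gt0.
rewrite opprB addrC lerD2r ler_wpM2l // lef_pV2 ?posrE ?exprn_gt0 //;
  rewrite ?mulr_gt0 ?addr_gt0 //.
by rewrite expr2 ler_wpM2r ?addr_ge0 ?lerDl // ltW.
Qed.

End Hitting.

(** * The Bernoulli measure *)

Section BernoulliCylinder.
Variables (R : realType) (Omega : alphabetType) (P : finprob R Omega).
Local Notation mu := (bernoulli P).

Lemma finprob_itv (a : Omega) : 0 <= P a <= 1.
Proof.
rewrite finprob_ge0 /= -(finprob_sum1 P) (bigD1 a) //= lerDl.
by apply: sumr_ge0 => b _; exact: finprob_ge0.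
Qed.

Lemma prefix_open (K : nat) (Q : set (seq Omega)) :
  [set alpha | Q (prefix_of alpha K)] =
  open_of [set tau | size tau = K /\ Q tau].
Proof.
apply/seteqP; split=> alpha /= => [Qa|[n [] ]]; last first.
  by rewrite size_mkseq => ->.
by exists K; rewrite /= size_mkseq.
Qed.

Lemma measurable_prefix (K : nat) (Q : set (seq Omega)) :
  measurable ([set alpha | Q (prefix_of alpha K)] : set (infseq Omega)).
Proof. by rewrite prefix_open; exact: measurable_open_of. Qed.

Lemma prefix_of_take (alpha : nat -> Omega) (m n : nat) :
  (m <= n)%N -> take m (prefix_of alpha n) = prefix_of alpha m.
Proof.
by move=> mn; rewrite /prefix_of /mkseq -map_take take_iota (minn_idPl mn).
Qed.

(** Marking the occurrences of [a] turns the Bernoulli measure into coin tossing with bias [P a].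
    Fixing a prefix [sigma] allows an induction on the number [K] of letters still to be read: the
    event is partitioned by the letter that follows [sigma]. *)
Lemma bernoulli_cylinder (a : Omega) (S : pred (seq bool)) (K : nat)
    (sigma : seq Omega) :
  mu [set alpha | prefix_of alpha (size sigma) = sigma /\
        S (map (pred1 a) (prefix_of alpha (size sigma + K)))] =
  ((\prod_(b <- sigma) P b) *
    expect (P a) K (fun s => (S (map (pred1 a) sigma ++ s))%:R))%:E.
Proof.
elim: K sigma => [|K IHK] sigma.
  rewrite addn0 /= cats0.
  case: (boolP (S (map (pred1 a) sigma))) => Ssigma.
    rewrite mulr1 -bernoulli_open_of; congr (mu _).
    apply/seteqP; split=> alpha /= => [[e _]|[n e]].
      by exists (size sigma); rewrite /= e.
    have en : size sigma = n by rewrite -e size_mkseq.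
    by rewrite en e.
  rewrite mulr0 (_ : [set _ | _] = set0) ?measure0 //.
  by apply/seteqP; split=> alpha //= [-> /(negP Ssigma)].
pose F b : set (infseq Omega) := [set alpha |
  prefix_of alpha (size (rcons sigma b)) = rcons sigma b /\
  S (map (pred1 a) (prefix_of alpha (size (rcons sigma b) + K)))].
have prefixS (alpha : nat -> Omega) n :
    prefix_of alpha n.+1 = rcons (prefix_of alpha n) (alpha n).
  by rewrite /prefix_of mkseqS.
have FE : [set alpha | prefix_of alpha (size sigma) = sigma /\
    S (map (pred1 a) (prefix_of alpha (size sigma + K.+1)))] =
    \bigcup_(b in [set` enum Omega]) F b.
  apply/seteqP; split=> alpha /=.
    move=> [e Sa]; exists (alpha (size sigma)) => /=; first by rewrite mem_enum.
    by split; rewrite size_rcons ?addSnnS // (prefixS _ (size sigma)) e.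
  move=> [b _] [] /=; rewrite size_rcons (prefixS _ (size sigma)) => /rcons_inj[e _].
  by rewrite addSnnS; split.
have mF b : measurable (F b).
  have := @measurable_prefix (size (rcons sigma b) + K) [set tau |
    take (size (rcons sigma b)) tau = rcons sigma b /\ S (map (pred1 a) tau)].
  congr measurable; apply/seteqP.
  by split=> alpha /=; rewrite prefix_of_take // leq_addr.
have tF : trivIset [set` enum Omega] F.
  move=> b c _ _ [alpha [[/= eb _] [ec _]]].
  by move: eb; rewrite size_rcons -(size_rcons sigma c) ec => /rcons_inj[].
rewrite FE measure_fin_bigcup;
  [|exact: finite_seq|exact: tF|by move=> b _; exact: mF].
rewrite -fsbig_seq ?enum_uniq // big_enum /=.
under eq_bigr => b _ do rewrite IHK -cats1 big_cat big_seq1 map_cat /=.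
rewrite sumEFin; congr EFin.
rewrite (bigD1 a) //= eqxx.
set E := expect _ _ _.
(* All letters other than [a] append the same mark [false], so they share one conditional
   expectation and their probabilities add up to [1 - P a]. *)
rewrite [X in _ + X](eq_bigr (fun b => \prod_(c <- sigma) P c * P b *
  expect (P a) K (fun s => (S (map (pred1 a) sigma ++ false :: s))%:R))); last first.
  by move=> b /negPf ->; under eq_expect do rewrite -catA.
rewrite -mulr_suml -mulr_sumr.
have -> : \sum_(b | b != a) P b = 1 - P a.
  by rewrite -(finprob_sum1 P) [in RHS](bigD1 a) //= addrAC subrr add0r.
rewrite /E; under eq_expect do rewrite -catA; rewrite /=; ring.
Qed.

End BernoulliCylinder.

(** * The measure of the sequences with a late bad prefix *)

Section HittingMeasure.
Variables (R : realType) (Omega : alphabetType) (P : finprob R Omega).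
Variables (a : Omega) (bad : nat -> nat -> bool) (lo C : nat).
Local Notation mu := (bernoulli P).

Hypothesis badC : forall K, (0 < K)%N ->
  expect (P a) K (fun s => (bad K (count id s))%:R) <= C%:R / K%:R ^+ 2.

Definition late_bad : set (seq Omega) :=
  [set tau | (lo <= size tau)%N && bad (size tau) (count_mem a tau)].

Let u K : R := expect (P a) K (fun s => (hit bad lo s)%:R).

Let F K : set (infseq Omega) :=
  [set alpha | hit bad lo (map (pred1 a) (prefix_of alpha K))].

Let mF K : measurable (F K).
Proof.
exact: (@measurable_prefix _ K [set tau | hit bad lo (map (pred1 a) tau)]).
Qed.

Let muF K : mu (F K) = (u K)%:E.
Proof.
have := bernoulli_cylinder P a (hit bad lo) K [::].
rewrite big_nil mul1r add0n /= => <-; congr (mu _).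
by apply/seteqP; split=> alpha //= [].
Qed.

Let F_ge K L : (K <= L)%N -> F K `<=` F L.
Proof.
move=> KL alpha; rewrite /F /= -(prefix_of_take alpha KL) map_take.
by apply: hit_take; rewrite size_map size_mkseq.
Qed.

Let open_late_bad : open_of late_bad = \bigcup_K F K.
Proof.
have badE (alpha : nat -> Omega) k L : (k <= L)%N ->
    bad k (count id (take k (map (pred1 a) (prefix_of alpha L)))) =
    bad k (count_mem a (prefix_of alpha k)).
  by move=> kL; rewrite -map_take prefix_of_take // count_map.
apply/seteqP; split=> alpha [K]; rewrite /= /F /=.
  rewrite /late_bad /= size_mkseq => /andP[lok kbad]; exists K => //=.
  by apply/hitP; exists K; rewrite badE // size_map size_mkseq.
move=> _ /hitP[k []]; rewrite size_map size_mkseq => lok kK.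
by rewrite badE // => kbad; exists k; rewrite /late_bad /= size_mkseq lok.
Qed.

(** The open set is the increasing union of the events [F K], of probability [u K]. By continuity
    from below, the bound [u K + C / K], valid for every later event, passes to the limit. *)
Lemma bernoulli_late_bad K : (0 < K)%N ->
  u K <= fine (mu (open_of late_bad)) <= u K + C%:R / K%:R.
Proof.
move=> K0; rewrite open_late_bad.
have mU : measurable (\bigcup_K F K).
  exact: bigcupT_measurable.
have muU : mu (\bigcup_K F K) \is a fin_num by exact: fin_num_measure.
rewrite -!lee_fin fineK // -muF; apply/andP; split.
  by apply: le_measure; rewrite ?inE //; exact: bigcup_sup.
have cvgF : mu \o F @ \oo --> mu (\bigcup_K F K).
  by apply: nondecreasing_cvg_mu => // K' L KL; apply/subsetPset/F_ge.
rewrite -(cvg_lim (@ereal_hausdorff R) cvgF).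
apply: lime_le; first by apply/cvg_ex; eexists; exact: cvgF.
exists K => // L /= KL; rewrite muF lee_fin.
rewrite -(subnKC KL).
exact: (@expect_hit_tail bad R (P a) lo (finprob_itv P a) C badC K _ K0).
Qed.

End HittingMeasure.

(** * The Schnorr test *)

(** With truncated subtraction one of the two summands vanishes, so the absolute difference is
    computed without signs. *)
Definition natdist (x y : nat) : nat := ((x - y) + (y - x))%N.

Lemma natdistE (R : realType) (x y : nat) :
  (natdist x y)%:R = `|x%:R - y%:R| :> R.
Proof.
rewrite /natdist; have [xy|/ltnW xy] := leqP x y.
  by rewrite (eqP xy) add0n distrC natrB // ger0_norm // subr_ge0 ler_nat.
by rewrite (eqP xy) addn0 natrB // ger0_norm // subr_ge0 ler_nat.
Qed.

(** Clamping the approximations to [0, 1] does not move them away from [x], and makes each of them a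
    legitimate coin bias. *)
Lemma rational_approximation (R : realType) (x : R) :
  computable_real x -> 0 <= x <= 1 ->
  exists A B : nat -> nat, [/\ recursive [:: id] A, recursive [:: id] B,
    forall k, (0 < B k)%N, forall k, (A k <= B k)%N &
    forall k, `|(A k)%:R / (B k)%:R - x| <= 2 ^- k].
Proof.
move=> [f [[s [p [q [hs hp hq fE]]]] fx]] /andP[x0 x1].
have rec1 g : total_recursive g -> recursive [:: id] (fun k => g [tuple k]).
  by move=> [c cP]; exists c => k; exact: (cP [tuple k]).
move/rec1 in hs; move/rec1 in hp; move/rec1 in hq.
pose B k := (q [tuple k]).+1.
(* An odd sign exponent gives a non-positive value, clamped to 0; the other branch is the minimum of
   [p] and [B k], written with truncated subtraction. *)
pose A k := if (0 < s [tuple k] %% 2)%N then 0%N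
  else (p [tuple k] - (p [tuple k] - B k))%N.
have hB : recursive [:: id] B by exact: recursive_succ.
have AB k : (A k <= B k)%N by rewrite /A; case: ifP => // _; lia.
exists A, B; split=> //.
  apply: recursive_if.
  - apply: recursive_leq; first exact: recursive_const.
    by apply: recursive_mod => //; exact: recursive_const.
  - exact: recursive_const.
  - by apply: recursive_sub => //; exact: recursive_sub.
move=> k; apply: ltW; apply: le_lt_trans (fx k).
rewrite fE !rmorphM /= rmorphXn rmorphN1 fmorphV /= -/(B k) !ratr_nat.
have B0 : 0 < (B k)%:R :> R by rewrite ltr0n.
rewrite -signr_odd /A modn2; case: (odd _) => /=.
  rewrite mulr0n mul0r sub0r normrN ger0_norm //.
  have r0 : 0 <= (p [tuple k])%:R / (B k)%:R :> R by rewrite divr_ge0.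
  rewrite expr1 mulN1r mulNr opprK ger0_norm ?addr_ge0 //.
  by rewrite lerDl.
rewrite expr0 mul1r distrC.
have [pB|/ltnW pB] := leqP (p [tuple k]) (B k).
  by rewrite (eqP pB) subn0.
rewrite subKn // divff ?gt_eqF // distrC.
have r1 : 1 <= (p [tuple k])%:R / (B k)%:R :> R.
  by rewrite ler_pdivlMr // mul1r ler_nat.
rewrite ger0_norm ?subr_ge0 // distrC ger0_norm ?lerD2r //.
by rewrite subr_ge0 (le_trans x1).
Qed.

(** * Recursive evaluation of the hitting probabilities *)

Section EffectiveTest.
Variables A B : nat -> nat.
Hypotheses (hA : recursive [:: id] A) (hB : recursive [:: id] B).
Hypotheses (B_gt0 : forall k, (0 < B k)%N) (A_le : forall k, (A k <= B k)%N).

Section Counting.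
Local Open Scope nat_scope.

(* [c] heads among [k] tosses are [k ^ (1/2 + 1/m)] away from [k A(k) / B(k)]. *)
Definition far (m k c : nat) : bool :=
  k ^ m.+2 * B k ^ m.*2 <= natdist (c * B k) (k * A k) ^ m.*2.

Definition toss (w j : nat) : bool := odd (w %/ 2 ^ j).

Definition hit_count (m lo K w : nat) : nat :=
  \sum_(k < K.+1) ((lo <= k) && far m k (\sum_(j < k) toss w j)).

(** The numerator, over the denominator [B N ^ K], of the probability of a hit within [K] tosses of
    bias [A N / B N]. *)
Definition hit_weight (m lo K N : nat) : nat :=
  \sum_(w < 2 ^ K) (0 < hit_count m lo K w) *
    \prod_(j < K) (if toss w j then A N else B N - A N).

Lemma hit_bits (m lo K w : nat) :
  hit (far m) lo (bits K w) = (0 < hit_count m lo K w).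
Proof.
have sz : size (bits K w) = K by rewrite size_mkseq.
have cnt k : k <= K -> count id (take k (bits K w)) = \sum_(j < k) toss w j.
  move=> kK; rewrite /bits /mkseq -map_take take_iota (minn_idPl kK).
  rewrite count_map -sum1_count big_mkcond.
  rewrite -(big_mkord xpredT (fun j => toss w j : nat)) /index_iota subn0.
  by apply: eq_bigr => j _; rewrite /= /toss; case: odd.
rewrite lt0n sum_nat_eq0 negb_forall.
apply/hitP/existsP => [[k [lok]]|[k]].
  rewrite sz => kK; rewrite cnt // => kbad; exists (Ordinal (kK : k < K.+1)).
  by rewrite /= lok kbad.
rewrite /= eqb0 negbK => /andP[lok kbad].
have kK : k <= K by rewrite -ltnS.
by exists k; rewrite sz cnt ?lok.
Qed.

Lemma recursive_toss (X : Type) (t : seq (X -> nat)) (w j : X -> nat) :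
  recursive t w -> recursive t j ->
  recursive t (fun x => toss (w x) (j x)).
Proof.
move=> hw hj; apply: (recursive_ext (F := fun x => (w x %/ 2 ^ j x) %% 2)).
  by move=> x; rewrite modn2.
apply: recursive_mod; last exact: recursive_const.
apply: recursive_div => //; apply: recursive_exp => //.
exact: recursive_const.
Qed.

Lemma recursive_far (X : Type) (t : seq (X -> nat)) (m : nat) (k c : X -> nat) :
  recursive t k -> recursive t c -> recursive t (fun x => far m (k x) (c x)).
Proof.
move=> hk hc; rewrite /far /natdist.
have hBk : recursive t (fun x => B (k x)) by exact: recursive_comp1.
have hAk : recursive t (fun x => A (k x)) by exact: recursive_comp1.
have hcst n : recursive t (fun=> n) by exact: recursive_const.
have h1 : recursive t (fun x => c x * B (k x)) by exact: recursive_mul.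
have h2 : recursive t (fun x => k x * A (k x)) by exact: recursive_mul.
apply: recursive_leq.
  by apply: recursive_mul; exact: recursive_exp.
by apply: recursive_exp => //; apply: recursive_add; exact: recursive_sub.
Qed.

Lemma recursive_hit_weight (X : Type) (t : seq (X -> nat)) (m : nat)
    (lo K N : X -> nat) :
  recursive t lo -> recursive t K -> recursive t N ->
  recursive t (fun x => hit_weight m (lo x) (K x) (N x)).
Proof.
move=> hlo hK hN; apply: (recursive_sum (G := fun w x =>
    (0 < hit_count m (lo x) (K x) w) *
    \prod_(j < K x) (if toss w j then A (N x) else B (N x) - A (N x)))).
  by apply: recursive_exp => //; exact: recursive_const.
apply: recursive_mul.
  apply: recursive_leq; first exact: recursive_const.
  apply: (recursive_sum (G := fun k u =>
      (lo u.2 <= k) && far m k (\sum_(j < k) toss u.1 j) : nat)).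
    by apply: recursive_succ; exact: (recursive_bind hK).
  apply: recursive_and.
    apply: recursive_leq; first exact: (recursive_bind (recursive_bind hlo)).
    exact: (recursive_var _ 0).
  apply: recursive_far; first exact: (recursive_var _ 0).
  apply: (recursive_sum (G := fun j u => toss u.2.1 j : nat)).
    exact: (recursive_var _ 0).
  (* The bound variables are, innermost first, [j], [k] and [w]. *)
  by apply: recursive_toss; [exact: (recursive_var _ 2)|exact: (recursive_var _ 0)].
apply: (recursive_prod (G := fun j u =>
    if toss u.1 j then A (N u.2) else B (N u.2) - A (N u.2))).
  exact: (recursive_bind hK).
have hN2 := recursive_bind (recursive_bind hN).
have hAN : recursive (bind (bind t)) (fun u => A (N u.2.2)).
  exact: (recursive_comp1 hA hN2).
have hBN : recursive (bind (bind t)) (fun u => B (N u.2.2)).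
  exact: (recursive_comp1 hB hN2).
apply: recursive_if => //; last exact: recursive_sub.
by apply: recursive_toss; [exact: (recursive_var _ 1)|exact: (recursive_var _ 0)].
Qed.

End Counting.

(** Multiplying by [B k ^ (2m)] clears the denominators, and the even exponent absorbs the absolute
    value in [natdist]. *)
Lemma farE (R : realType) (m k c : nat) :
  far m k c =
  (k%:R ^+ m.+2 <= (c%:R - k%:R * ((A k)%:R / (B k)%:R)) ^+ m.*2 :> R).
Proof.
have b0 : 0 < (B k)%:R :> R by rewrite ltr0n.
rewrite -(ler_pM2r (_ : 0 < (B k)%:R ^+ m.*2)) ?exprn_gt0 // -exprMn.
have -> : (c%:R - k%:R * ((A k)%:R / (B k)%:R)) * (B k)%:R =
    (c * B k)%:R - (k * A k)%:R :> R.
  by rewrite !natrM; field; rewrite gt_eqF.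
by rewrite -(normr_expr_double (_ - _)) -natdistE -!natrX -natrM ler_nat.
Qed.

Lemma expect_hit_weight (R : realType) (m lo K N : nat) :
  expect ((A N)%:R / (B N)%:R : R) K (fun s => (hit (far m) lo s)%:R) =
  (hit_weight m lo K N)%:R / (B N ^ K)%:R.
Proof.
have b0 : (B N)%:R != 0 :> R by rewrite pnatr_eq0 -lt0n.
rewrite expect_bits natr_sum mulr_suml; apply: eq_bigr => w _.
rewrite hit_bits natrM -mulrA; congr (_ * _).
rewrite /bits /mkseq big_map (_ : iota 0 K = index_iota 0 K); last first.
  by rewrite /index_iota subn0.
have -> : (B N ^ K)%:R = \prod_(j < K) (B N)%:R :> R.
  by rewrite prodr_const card_ord natrX.
rewrite big_mkord natr_prod.
rewrite -prodf_div; apply: eq_bigr => j _; rewrite /toss.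
case: odd => //; rewrite natrB // mulrBl divff //.
Qed.

End EffectiveTest.

(** The code searches for a zero of [1 - chi], which ignores the search variable: it halts at 0 or
    never. *)
Lemma rec_enumerable_decidable (Omega : finType) (chi : nat -> nat -> bool) :
  recursive [:: fst; snd] (fun u => chi u.1 u.2 : nat) ->
  rec_enumerable [set x : nat * seq Omega | chi x.1 (string_code x.2)].
Proof.
move=> hchi.
have [c cP] : recursive (bind [:: fst; snd])
    (fun u => (1 - chi u.2.1 u.2.2)%N).
  by apply: recursive_sub; [exact: recursive_const|exact: recursive_bind hchi].
exists (Mu c) => n sigma /=.
have cE y := cP (y, (n, string_code sigma)).
split=> [chi1|[y [/(eval_det (cE y)) + _]]]; last by rewrite /=; case: (chi _ _).
by exists 0%N; split=> //; have := cE 0%N; rewrite /= chi1.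
Qed.

Lemma total_recursive2 (g : nat -> nat -> nat) :
  recursive [:: fst; snd] (fun u => g u.1 u.2) ->
  total_recursive (fun v : 2.-tuple nat => g (nth 0 v 0) (nth 0 v 1))%N.
Proof.
move=> [c cP]; exists c => -[[|x [|y []]] //= sz].
exact: (cP (x, y)).
Qed.

Lemma natr_lt_exp2 (R : realType) (K : nat) : K%:R < 2 ^+ K :> R.
Proof. by rewrite -natrX ltr_nat ltn_expl. Qed.

Section SchnorrTest.
Variables (R : realType) (Omega : alphabetType) (P : finprob R Omega).
Variables (a : Omega) (A B : nat -> nat) (m C : nat).
Hypotheses (hA : recursive [:: id] A) (hB : recursive [:: id] B).
Hypotheses (B_gt0 : forall k, (0 < B k)%N) (A_le : forall k, (A k <= B k)%N).
Hypothesis A_near : forall k, `|(A k)%:R / (B k)%:R - P a| <= 2 ^- k.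
Hypothesis far_bound : forall K, (0 < K)%N ->
  expect (P a) K (fun s => (far A B m K (count id s))%:R) <= C%:R / K%:R ^+ 2.

Let p := P a.
(** At length [C 2 ^ n + 1], just below [lo n], nothing has been hit yet, and the tail bound
    [C / (C 2 ^ n + 1)] is already less than [2 ^- n]. *)
Let lo (n : nat) := (C * 2 ^ n).+2.
Let test : set (nat * seq Omega) :=
  [set x | (0 < x.1)%N && ((lo x.1 <= size x.2)%N
           && far A B m (size x.2) (count_mem a x.2))].

Let slice_test n : (0 < n)%N -> slice test n = late_bad a (far A B m) (lo n).
Proof.
by move=> n0; apply/seteqP; split=> s; rewrite /slice /test /late_bad /= n0.
Qed.

Let recursive_lo (X : Type) (t : seq (X -> nat)) (F : X -> nat) :
  recursive t F -> recursive t (fun x => (C * 2 ^ F x)%N).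
Proof.
move=> hF; apply: recursive_mul; first exact: recursive_const.
by apply: recursive_exp => //; exact: recursive_const.
Qed.

Let re_test : rec_enumerable test.
Proof.
(* Membership depends only on the length of the word and its number of letters [a], and both are
   recovered from its code. *)
pose len := digit_count #|Omega| xpredT.
pose cnt := digit_count #|Omega| (pred1 (enum_rank a : nat)).
have hlen : recursive [:: id] len.
  by apply: recursive_digit_count; exact: recursive_const.
have hcnt : recursive [:: id] cnt.
  apply: recursive_digit_count; apply: recursive_eq; last exact: recursive_const.
  exact: (recursive_var [:: id] 0).
have lenE (s : seq Omega) : len (string_code s) = size s.
  by rewrite /len digit_count_string_code count_predT.
have cntE (s : seq Omega) : cnt (string_code s) = count_mem a s.
  rewrite /cnt digit_count_string_code.
  by apply: eq_count => b /=; rewrite (inj_eq val_inj) (inj_eq enum_rank_inj).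
pose chi n c := (0 < n)%N && ((lo n <= len c)%N && far A B m (len c) (cnt c)).
have -> : test = [set x | chi x.1 (string_code x.2)].
  by apply/seteqP; split=> -[n s]; rewrite /test /chi /= lenE cntE.
have h0 : recursive [:: fst; snd] fst by exact: (recursive_var [:: fst; snd] 0).
have h1 : recursive [:: fst; snd] snd by exact: (recursive_var [:: fst; snd] 1).
have hlen1 := recursive_comp1 hlen h1; have hcnt1 := recursive_comp1 hcnt h1.
apply: rec_enumerable_decidable; rewrite /chi; apply: recursive_and.
  by apply: recursive_leq => //; exact: recursive_const.
apply: recursive_and; last exact: recursive_far.
by apply: recursive_leq => //; do 2! apply: recursive_succ; exact: recursive_lo.
Qed.

Let mu n := bernoulli P (open_of (slice test n)).

Let mu_fin n : mu n \is a fin_num.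
Proof. by apply: fin_num_measure; exact: measurable_open_of. Qed.

Let mu_bounds n K : (0 < n)%N -> (0 < K)%N ->
  expect p K (fun s => (hit (far A B m) (lo n) s)%:R) <= fine (mu n) <=
  expect p K (fun s => (hit (far A B m) (lo n) s)%:R) + C%:R / K%:R.
Proof.
by move=> n0 K0; rewrite /mu slice_test //; exact: bernoulli_late_bad.
Qed.

Let natC n : ((C * 2 ^ n).+1)%:R = C%:R * 2 ^+ n + 1 :> R.
Proof. by rewrite -natr1 natrM natrX. Qed.

Let mu_small n : (0 < n)%N -> (mu n < (2 ^- n)%:E)%E.
Proof.
move=> n0; rewrite -(fineK (mu_fin n)) lte_fin.
have /andP[_] := @mu_bounds n (C * 2 ^ n).+1 n0 isT.
rewrite expect_hit0 // add0r => /le_lt_trans; apply.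
rewrite ltr_pdivrMr ?ltr0n // natC mulrDr.
rewrite mulrCA mulVf ?expf_neq0 // mulr1 mulr1.
by rewrite ltrDl invr_gt0 exprn_gt0.
Qed.

(** With this cut-off the neglected lengths contribute at most [C / K <= 2 ^- (k + 2)]. *)
Let K_of (k : nat) := (C * 2 ^ k.+2).+1.
(** The rational bias within [2 ^- N] costs at most [K 2 ^- N <= 2 ^- (k + 2)], because [K < 2 ^ K].
    Both errors together stay below [2 ^- k]. *)
Let N_of (k : nat) := (K_of k + k.+2)%N.

Let mu_near n k : (0 < n)%N ->
  `|fine (mu n) - (hit_weight A B m (lo n) (K_of k) (N_of k))%:R
                    / (B (N_of k) ^ K_of k)%:R| < 2 ^- k.
Proof.
move=> n0; rewrite -expect_hit_weight //.
set K := K_of k; set N := N_of k; set q := _ / _.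
set h := fun s => (hit (far A B m) (lo n) s)%:R : R.
have /andP[lb ub] := @mu_bounds n K n0 isT.
have e0 : 0 < 2 ^- k.+2 :> R by rewrite invr_gt0 exprn_gt0.
have q01 : 0 <= q <= 1.
  rewrite divr_ge0 //= ler_pdivrMr ?ltr0n // mul1r ler_nat; exact: A_le.
have h01 s : 0 <= h s <= 1 by rewrite /h; case: hit; rewrite ?lexx ?ler01.
have pq := expect_lipschitz K (finprob_itv P a) q01 h01.
have Kpq : K%:R * `|p - q| <= 2 ^- k.+2.
  rewrite distrC; apply: (@le_trans _ _ (2 ^+ K * 2 ^- N)).
    by apply: ler_pM => //; [apply: ltW; exact: natr_lt_exp2|exact: A_near].
  by rewrite /N /N_of -/K exprD invfM mulrA divff ?mul1r // expf_neq0.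
have CK : C%:R / K%:R <= 2 ^- k.+2 :> R.
  rewrite ler_pdivrMr ?ltr0n // natC mulrDr.
  by rewrite mulrCA mulVf ?expf_neq0 // !mulr1 lerDl ltW.
have k4 : 2 ^- k = 4 * 2 ^- k.+2 :> R.
  by rewrite !exprS; field; rewrite expf_neq0.
have := le_trans pq Kpq; rewrite ler_norml -/p => /andP[l1 l2].
rewrite k4 ltr_norml; apply/andP; split; lra.
Qed.

Lemma schnorr_test_late_far : schnorr_test P test.
Proof.
split; first by split; [move=> n s /andP[]|exact: re_test|exact: mu_small].
pose W n k := hit_weight A B m (lo n) (K_of k) (N_of k).
(* The predecessor, because [total_recursive_rat] presents a denominator as a successor. *)
pose D (_ k : nat) := (B (N_of k) ^ K_of k).-1%N.
pose on2 (g : nat -> nat -> nat) (v : 2.-tuple nat) :=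
  g (nth 0 v 0)%N (nth 0 v 1)%N.
exists (fun v => (-1) ^+ 0 * (on2 W v)%:R / (on2 D v).+1%:R).
have h0 : recursive [:: fst; snd] fst by exact: (recursive_var [:: fst; snd] 0).
have h1 : recursive [:: fst; snd] snd by exact: (recursive_var [:: fst; snd] 1).
have hK : recursive [:: fst; snd] (fun u => K_of u.2).
  by apply: recursive_succ; apply: recursive_lo; do 2! apply: recursive_succ.
have hN : recursive [:: fst; snd] (fun u => N_of u.2).
  by apply: recursive_add => //; do 2! apply: recursive_succ.
split.
  exists (fun=> 0%N), (on2 W), (on2 D); split; last by [].
  - by exists Zero.
  - apply: (total_recursive2 (g := W)); apply: recursive_hit_weight => //.
    by do 2! apply: recursive_succ; exact: recursive_lo.
  - apply: (total_recursive2 (g := D)).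
    apply: recursive_pred; apply: recursive_exp => //.
    exact: recursive_comp1.
move=> n k n0; rewrite expr0 mul1r rmorphM /= fmorphV !ratr_nat /on2 /W /D /=.
by rewrite prednK ?expn_gt0 ?B_gt0 // ratr_nat; exact: mu_near.
Qed.

Lemma schnorr_random_eventually_near (alpha : nat -> Omega) :
  schnorr_random P alpha -> exists M, forall k, (M <= k)%N ->
    ~~ far A B m k (count_mem a (prefix_of alpha k)).
Proof.
move=> /(_ _ schnorr_test_late_far)[n [n0 nin]]; exists (lo n) => k lok.
apply/negP => kfar; apply: nin; rewrite slice_test //; exists k.
by rewrite /late_bad /= size_mkseq lok.
Qed.

End SchnorrTest.

(** One factor [n] absorbs [4 ^ m], leaving [n ^ (2m + 1)] to be compared with
    [n ^ ((2 + eps) (m - 2))]. The condition [5 + 2 eps <= eps m] says exactly that the second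
    exponent is at least the first. *)
Lemma powR_threshold (R : realType) (eps : R) (m n k : nat) :
  (2 < m)%N -> 5 + 2 * eps <= eps * m%:R -> (4 ^ m <= n)%N ->
  n%:R `^ (2 + eps) <= k%:R -> 4 ^+ m * n%:R ^+ m.*2 <= k%:R ^+ (m - 2) :> R.
Proof.
move=> m2 meps n4 nk.
have n1 : (1 <= n)%N by apply: leq_trans n4; rewrite expn_gt0.
apply: (@le_trans _ _ (n%:R ^+ m.*2.+1)).
  by rewrite exprS ler_wpM2r ?exprn_ge0 // -natrX ler_nat.
apply: (@le_trans _ _ ((n%:R `^ (2 + eps)) ^+ (m - 2))); last first.
  by rewrite lerXn2r ?nnegrE ?powR_ge0.
rewrite -!powR_mulrn ?powR_ge0 // -powRrM ler_powR ?ler1n //.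
rewrite natrB 1?ltnW // -natr1 -muln2 natrM; lra.
Qed.

Theorem theorem6 (R : realType) (Omega : alphabetType) (P : finprob R Omega)
    (P_computable : computable_finprob P)
    (alpha : nat -> Omega) (alpha_random : schnorr_random P alpha)
    (eps : R) (eps_gt0 : 0 < eps) :
  exists M : nat, (0 < M)%N /\
    forall n k : nat, (M <= n)%N -> (0 < k)%N ->
      n%:R `^ (2%:R + eps) <= k%:R ->
      forall a : Omega,
        `|(count_mem a (prefix_of alpha k))%:R / k%:R - P a| < 1 / n%:R.
Proof.
pose ok a (M : nat) := forall n k : nat, (M <= n)%N -> (0 < k)%N ->
  n%:R `^ (2%:R + eps) <= k%:R ->
  `|(count_mem a (prefix_of alpha k))%:R / k%:R - P a| < 1 / n%:R.
(* The alphabet is finite, so thresholds found letter by letter have a maximum. *)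
suff /choice[M okM] : forall a, exists M, ok a M.
  exists (\max_a M a).+1; split=> // n k Mn k0 nk a; apply: okM => //.
  by apply: leq_trans Mn; rewrite ltnW // ltnS; exact: leq_bigmax.
move=> a; have [A [B [hA hB B0 AB A_near]]] :=
  rational_approximation (P_computable a) (finprob_itv P a).
(* One successor exceeds the quotient, as [powR_threshold] demands; the other two ensure [2 < m]. *)
pose m := (Num.truncn ((5 + 2 * eps) / eps)).+3.
have m_eps : 5 + 2 * eps <= eps * m%:R.
  rewrite [leRHS]mulrC -ler_pdivrMr //; apply/ltW.
  apply: lt_le_trans (truncnS_gt _) _.
  by rewrite ler_nat /m; apply: leq_trans (leqnSn _) (leqnSn _).
have K2 K : K%:R * `|(A K)%:R / (B K)%:R - P a| <= 1.
  apply: (@le_trans _ _ (2 ^+ K * 2 ^- K)).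
    by apply: ler_pM => //; apply: ltW; exact: natr_lt_exp2.
  by rewrite divff // expf_neq0.
have [C CP] := deviation_bound R m.
have far_bound K : (0 < K)%N ->
    expect (P a) K (fun s => (far A B m K (count id s))%:R) <= C%:R / K%:R ^+ 2.
  move=> K0; under eq_expect do rewrite (farE A B0 R).
  exact: CP (finprob_itv P a) K0 (K2 K).
have [M0 M0P] := schnorr_random_eventually_near hA hB B0 AB A_near far_bound
  alpha_random.
(* [M0] serves for [k] since [n <= k]; [4 ^ m] pays for halving the deviation below. *)
exists (maxn M0 (4 ^ m)) => n k; rewrite geq_max => /andP[M0n n4] k0 nk.
have n2 : (2 <= n)%N by apply: leq_trans n4; rewrite /m expnS; lia.
have n0 : 0 < n%:R :> R by rewrite ltr0n (leq_trans _ n2).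
have kR : 0 < k%:R :> R by rewrite ltr0n.
have nnk : n%:R ^+ 2 <= k%:R :> R.
  apply: le_trans nk; rewrite -powR_mulrn ?(ltW n0) // ler_powR ?ler1n ?(ltnW n2) //.
  by rewrite lerDl ltW.
have nk2 : n%:R * 2 <= k%:R :> R.
  by apply: le_trans nnk; rewrite expr2 ler_wpM2l ?(ltW n0) // (ler_nat _ 2).
have nlek : (n <= k)%N by rewrite -(ler_nat R); lra.
have := M0P k (leq_trans M0n nlek).
rewrite (farE A B0 R) -ltNge; set s := count_mem _ _; set q := _ / _.
apply: contraLR; rewrite -!leNgt => dev_big.
have sk : k%:R / n%:R <= `|s%:R - k%:R * P a|.
  have -> : s%:R - k%:R * P a = k%:R * (s%:R / k%:R - P a).
    by field; rewrite gt_eqF.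
  by rewrite normrM gtr0_norm // ler_pM2l // -div1r.
(* Replacing [P a] by [q] moves the centre by at most 1, and [1 <= k / (2n)], so half of the
   deviation survives. *)
have sq : k%:R / (2 * n%:R) <= `|s%:R - k%:R * q|.
  have kq : `|k%:R * (q - P a)| <= 1 by rewrite normrM gtr0_norm // K2.
  have e : s%:R - k%:R * P a = s%:R - k%:R * q + k%:R * (q - P a) by ring.
  have half : k%:R / n%:R = k%:R / (2 * n%:R) + k%:R / (2 * n%:R) :> R.
    by field; rewrite gt_eqF.
  have one : 1 <= k%:R / (2 * n%:R) :> R.
    by rewrite ler_pdivlMr ?mulr_gt0 // mul1r mulrC.
  have := ler_normD (s%:R - k%:R * q) (k%:R * (q - P a)); rewrite -e; lra.
rewrite -[leRHS]normr_expr_double.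
apply: (@le_trans _ _ ((k%:R / (2 * n%:R)) ^+ m.*2)); last first.
  by rewrite lerXn2r ?nnegrE // divr_ge0 // mulr_ge0.
rewrite expr_div_n ler_pdivlMr ?exprn_gt0 ?mulr_gt0 //.
(* Splitting the exponent of [k] lets [k ^ (m + 2)] cancel, which leaves
   [(2n) ^ (2m) <= k ^ (m - 2)]. *)
have -> : m.*2 = (m.+2 + (m - 2))%N by rewrite /m; lia.
rewrite [leRHS]exprD ler_pM2l ?exprn_gt0 //.
have -> : (m.+2 + (m - 2) = m.*2)%N by rewrite /m; lia.
have e4 : 2 ^+ m.*2 = 4 ^+ m :> R.
  by rewrite -mul2n exprM; congr (_ ^+ m); ring.
by rewrite exprMn e4; exact: powR_threshold m_eps n4 nk.
Qed.
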